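(* Suppose that $$\sum_{i=1}^j \left[\kappa_{i-1}(u_i-u_{i-1})+d_i\right]\ge 0 \quad\text{and}\quad \sum_{i=j}^n \left[\kappa_i(u_{i+1}-u_i)+d_i\right]\ge 0 \qquad \text{for all } j=1,\ldots,n,$$ where $\kappa_i=k_i/a_i^2$. Then there exists a self-similar increasing solution of the multi-phase Stefan problem with Riemann initial data described in the context.
   Context: Let $n\ge 1$ be an integer, let $u_-=u_0<u_1<\cdots<u_n<u_{n+1}=u_+$ be real numbers (the $u_i$, $1\le i\le n$, are phase transition temperatures), let $a_i>0$ and $k_i>0$ for $i=0,\ldots,n$, and let $d_i\in\mathbb{R}$ for $i=1,\ldots,n$ be arbitrary real numbers (of any sign). The Stefan problem in the half-plane $\{(t,x): t>0,\ x\in\mathbb{R}\}$: find $u(t,x)$ and phase transition lines $x=x_i(t)$, $i=1,\ldots,n$, on which $u=u_i$, such that (a) $u_t=a_i^2u_{xx}$ in the region where $u_i<u<u_{i+1}$, $i=0,\ldots,n$; (b) $d_i x_i'(t)+k_iu_x(t,x_i(t)+)-k_{i-1}u_x(t,x_i(t)-)=0$ on $x=x_i(t)$, $i=1,\ldots,n$ (Stefan condition, with one-sided derivatives); (c) $u(0,x)=u_-$ for $x<0$ and $u(0,x)=u_+$ for $x>0$ (as the limit as $t\to0+$). Let $F(\xi)=\frac{1}{2\sqrt{\pi}}\int_{-\infty}^{\xi}e^{-s^2/4}\,ds$, with $F(-\infty)=0$, $F(+\infty)=1$. A self-similar increasing solution is a solution $u(t,x)=v(\xi)$, $\xi=x/\sqrt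 t$, for which there are numbers $-\infty=\xi_0<\xi_1<\cdots<\xi_n<\xi_{n+1}=+\infty$ such that the phase transition lines are $x_i(t)=\xi_i\sqrt t$, $v$ is continuous with $v(\xi_i)=u_i$ for $1\le i\le n$, and $$v(\xi)=u_i+\frac{u_{i+1}-u_i}{F(\xi_{i+1}/a_i)-F(\xi_i/a_i)}\left(F(\xi/a_i)-F(\xi_i/a_i)\right),\quad \xi_i<\xi<\xi_{i+1},\ i=0,\ldots,n.$$ *)

(* Defs.v *)
From HB Require Import structures.
From mathcomp Require Import all_boot all_order all_algebra.
From mathcomp Require Import all_classical all_reals all_analysis.

Set Implicit Arguments.
Unset Strict Implicit.
Unset Printing Implicit Defensive.
Import Order.TTheory GRing.Theory Num.Theory.
Import numFieldNormedType.Exports.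
Local Open Scope classical_set_scope.
Local Open Scope ring_scope.

(* Indexed data are total functions on nat, of which only a finite range is
   ever read: temperatures ut i for i <= n.+1 (ut 0 is u_-, ut n.+1 is u_+),
   diffusion and conductivity coefficients a i, k i for i <= n, latent heats
   d i and phase transition lines x i for 1 <= i <= n. *)

(* One-sided derivatives of f at x, as limits of difference quotients. *)
Definition is_right_derive (R : realType) (f : R -> R) (x l : R) : Prop :=
  (fun h : R => h^-1 * (f (x + h) - f x)) @ 0^'+ --> l.

Definition is_left_derive (R : realType) (f : R -> R) (x l : R) : Prop :=
  (fun h : R => h^-1 * (f (x + h) - f x)) @ 0^'- --> l.

(* In u t x, the first argument is time. *)
Definition heat_equation_at (R : realType) (c : R) (u : R -> R -> R)
    (t x : R) : Prop :=
  [/\ derivable (fun s : R => u s x) t 1,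
      (\forall y \near x, derivable (u t) y 1),
      derivable (derive1 (u t)) x 1
    & derive1 (fun s : R => u s x) t = c ^+ 2 * derive1 (derive1 (u t)) x].

Definition stefan_condition_at (R : realType) (kl kr d : R) (u : R -> R -> R)
    (x : R -> R) (t : R) : Prop :=
  derivable x t 1 /\
  exists uxl uxr : R,
    [/\ is_left_derive (u t) (x t) uxl,
        is_right_derive (u t) (x t) uxr
      & d * derive1 x t + kr * uxr - kl * uxl = 0].

Definition stefan_riemann_solution (R : realType) (n : nat)
    (ut a k d : nat -> R) (u : R -> R -> R) (x : nat -> R -> R) : Prop :=
  [/\ (forall (i : nat) (t : R), (1 <= i <= n)%N -> 0 < t ->
         u t (x i t) = ut i),
      (forall (i : nat) (t y : R), (i <= n)%N -> 0 < t ->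
         ut i < u t y < ut i.+1 -> heat_equation_at (a i) u t y),
      (forall (i : nat) (t : R), (1 <= i <= n)%N -> 0 < t ->
         stefan_condition_at (k i.-1) (k i) (d i) u (x i) t),
      (forall y : R, y < 0 -> u t y @[t --> 0^'+] --> ut 0%N)
    & (forall y : R, 0 < y -> u t y @[t --> 0^'+] --> ut n.+1)].

Definition heatF (R : realType) (z : \bar R) : R :=
  match z with
  | r%:E => (2 * Num.sqrt pi)^-1 *
            Rintegral lebesgue_measure `]-oo, r] (fun s : R => expR (- s ^+ 2 / 4))
  | +oo%E => 1
  | -oo%E => 0
  end.

(* The extended sequence -oo = xi_0, xi_1, ..., xi_n, xi_{n+1} = +oo. *)
Definition xibar (R : realType) (n : nat) (xi : nat -> R) (i : nat) : \bar R :=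
  if i == 0%N then -oo%E else if (i <= n)%N then (xi i)%:E else +oo%E.

Definition self_similar_increasing_solution (R : realType) (n : nat)
    (ut a k d : nat -> R) (u : R -> R -> R) : Prop :=
  exists (v : R -> R) (xi : nat -> R),
    let b (i j : nat) : R := heatF (xibar n xi i * ((a j)^-1)%:E)%E in
    [/\ stefan_riemann_solution n ut a k d u (fun i t => xi i * Num.sqrt t),
        (forall t y : R, 0 < t -> u t y = v (y / Num.sqrt t)),
        (forall i : nat, (i <= n)%N -> (xibar n xi i < xibar n xi i.+1)%E),
        continuous v /\ (forall i : nat, (1 <= i <= n)%N -> v (xi i) = ut i)
      & forall (i : nat) (z : R), (i <= n)%N ->
          (xibar n xi i < z%:E)%E -> (z%:E < xibar n xi i.+1)%E ->
          v z = ut i + (ut i.+1 - ut i) / (b i.+1 i - b i i) *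
                       (heatF (z / a i)%:E - b i i)].

(* Main.v *)
From HB Require Import structures.
Require Import Defs.
From mathcomp Require Import all_boot all_order all_algebra.
From mathcomp Require Import all_classical all_reals all_analysis.
From mathcomp Require Import ring lra zify.
Set Implicit Arguments.
Unset Strict Implicit.
Unset Printing Implicit Defensive.
Import Order.TTheory GRing.Theory Num.Theory.
Import numFieldNormedType.Exports.
Local Open Scope classical_set_scope.
Local Open Scope ring_scope.

(** The Stefan condition at [xi_i] is the vanishing of the partial derivative in
    [xi_i] of the energy
<<
      E(xi) = - sum_{i=0}^n w_i ln (F(xi_{i+1}/a_i) - F(xi_i/a_i))
              + sum_{i=1}^n d_i xi_i^2 / 4,      w_i = k_i (u_{i+1} - u_i),
>>
    on the open convex set of increasing vectors ([energy_critical],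
    [stefan_selfsim]).  It therefore suffices that E attains its minimum there.
    As the [d_i] may be negative this is a competition between two quadratic
    terms, and the hypotheses are what keeps the second one from winning.

    A Gaussian mass decays like the exponential of minus a quarter of the squared
    distance [dist2] from 0 to the rescaled interval: writing
<<
      - ln (F(xi_{i+1}/a_i) - F(xi_i/a_i)) = dist2_i / 4 + defect_i,
>>
    one has [defect_i >= 0].  The squared distance only sees the negative part of
    [xi_{i+1}] and the positive part of [xi_i], so the quadratic terms of E add up
    to one quarter of
<<
      sum_i (w_{i-1}/a_{i-1}^2 + d_i) min(xi_i, 0)^2
    + sum_i (w_i/a_i^2 + d_i) max(xi_i, 0)^2.
>>
    The squares in the first sum decrease with i and those in the second
    increase, hence both sums are nonnegative by summation by parts, from the
    assumption on prefix sums for the first and on suffix sums for the second.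
    This gives [sum_i w_i defect_i <= E] ([energy_ge_defect]).

    On a sublevel set of E every defect is thus bounded, and a bounded defect is a
    strong constraint because the Gaussian tail is smaller than its exponential
    bound by a factor of order 1/|y|: the defect of the first interval bounds
    [xi_1] from below, that of the last one bounds [xi_n] from above, and those of
    the other intervals bound the gaps from below ([defect_first],
    [defect_last], [defect_mid]).  Sublevel sets are compact, also when the sums in
    the hypotheses vanish, and a minimizer exists ([energy_minimizer]).

    Given the critical point, the profile is a sum of ramps, one per interval, and
    the heat equation, the Stefan conditions and the initial values are read off
    from its explicit form on each interval. *)

(** * The Gaussian distribution function *)

Section gaussian.
Context {R : realType}.
Implicit Types x y z : R.

Definition gaussc : R := (2 * Num.sqrt pi)^-1.
Definition gaussd x : R := gaussc * expR (- x ^+ 2 / 4).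

Lemma gaussc_gt0 : 0 < gaussc.
Proof. by rewrite invr_gt0 mulr_gt0 ?sqrtr_gt0 ?pi_gt0. Qed.

Lemma gaussc_le_half : gaussc <= 1 / 2.
Proof.
have h : 1 <= Num.sqrt pi :> R.
  rewrite -[leLHS]sqrtr1 ler_sqrt ?pi_ge0//; have := @pi_ge2 R; lra.
by rewrite /gaussc div1r lef_pV2 ?posrE ?mulr_gt0 ?(lt_le_trans ltr01)//; lra.
Qed.

Lemma gaussd_gt0 x : 0 < gaussd x.
Proof. by rewrite mulr_gt0 ?gaussc_gt0 ?expR_gt0. Qed.

Lemma gaussd_normal x : gaussd x = normal_pdf 0 (Num.sqrt 2) x.
Proof.
have s0 : Num.sqrt 2 != 0 :> R by rewrite gt_eqF// sqrtr_gt0.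
rewrite normal_pdfE// /normal_peak /normal_fun sqr_sqrtr// subr0.
rewrite /gaussd /gaussc; congr (_ ^-1 * expR (_ / _)).
  rewrite -mulrnAl -[2 *+ 2](_ : 2 ^+ 2 = _ :> R); last by ring.
  by rewrite sqrtrM ?sqr_ge0// sqrtr_sqr ger0_norm.
by ring.
Qed.

Definition gaussF x : R := heatF x%:E.

Let mu := @lebesgue_measure R.

Lemma integrable_gaussd (A : set R) : measurable A ->
  mu.-integrable A (EFin \o gaussd).
Proof.
move=> mA; apply: (integrableS measurableT) => //.
have := @integrable_normal_pdf R 0 (Num.sqrt 2).
by under eq_fun do rewrite -gaussd_normal.
Qed.

Lemma gaussFE x : gaussF x = Rintegral mu `]-oo, x] gaussd.
Proof.
rewrite /gaussF /= /gaussd -/gaussc -RintegralZl//.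
have -> : EFin \o (fun s : R => expR (- s ^+ 2 / 4)) =
    (fun s => gaussc^-1%:E * (EFin \o gaussd) s)%E.
  by apply/funext => s /=; rewrite -EFinM mulKf// gt_eqF// gaussc_gt0.
by apply: integrableZl => //; exact: integrable_gaussd.
Qed.

Lemma gaussF_normal x : (gaussF x)%:E = normal_prob 0 (Num.sqrt 2) `]-oo, x].
Proof.
rewrite gaussFE /Rintegral /normal_prob fineK; last first.
  by apply: integrable_fin_num => //; exact: integrable_gaussd.
by apply: eq_integral => s _; rewrite gaussd_normal.
Qed.

Lemma continuous_gaussd : continuous gaussd.
Proof.
rewrite (_ : gaussd = normal_pdf 0 (Num.sqrt 2)); last first.
  by apply/funext => x; exact: gaussd_normal.
by apply: continuous_normal_pdf; rewrite gt_eqF// sqrtr_gt0.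
Qed.

Global Instance is_derive_gaussF x : is_derive x 1 gaussF (gaussd x).
Proof.
have xx1 : x < x + 1 by rewrite ltrDl.
have [||d1 d2] := @continuous_FTC1 R gaussd -oo%O x (x + 1) xx1 _ _
   (@continuous_gaussd x).
- exact: integrable_gaussd.
- by rewrite ltNyr.
rewrite (_ : gaussF = fun y => Rintegral mu `]-oo, y] gaussd); last first.
  by apply/funext => y; exact: gaussFE.
by apply: DeriveDef => //; rewrite -derive1E.
Qed.

(** The identity is a random variable whose law is the centred normal law of
    variance 2, so [gaussF] inherits the limits of a distribution function. *)
Let identityR : measurableTypeR R -> R := idfun.

HB.instance Definition _ :=
  @isMeasurableFun.Build _ _ _ _ identityR (@measurable_id _ _ setT).

Let gaussF_cdf x : gaussF x = fine
  (cdf (identityR : {RV (normal_prob 0 (Num.sqrt 2) : probability _ R) >-> R}) x).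
Proof. by rewrite -[LHS]/(fine (gaussF x)%:E) gaussF_normal. Qed.

Lemma gaussF_cvgNy : gaussF z @[z --> -oo] --> (0 : R).
Proof.
under eq_fun do rewrite gaussF_cdf.
by apply: fine_cvg; exact: cvg_cdfNy0.
Qed.

Lemma gaussF_cvgy : gaussF z @[z --> +oo] --> (1 : R).
Proof.
under eq_fun do rewrite gaussF_cdf.
by apply: fine_cvg; exact: cvg_cdfy1.
Qed.

Lemma gaussF_lt x y : x < y -> gaussF x < gaussF y.
Proof.
move=> xy; apply: (@gtr0_derive1_incr _ gaussF x y); rewrite ?lexx//.
- by move=> z _; rewrite derive1E derive_val gaussd_gt0.
- apply: continuous_subspaceT => z; apply: differentiable_continuous.
  by apply/derivable1_diffP.
Qed.

Lemma gaussF_gt0 x : 0 < gaussF x.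
Proof.
apply: (@le_lt_trans _ _ (gaussF (x - 1))); last by rewrite gaussF_lt// ltrBlDr ltrDl.
apply: (cvgr_to_le gaussF_cvgNy); near=> z; apply/ltW/gaussF_lt; near: z.
by apply: nbhs_ninfty_lt; rewrite num_real.
Unshelve. all: by end_near. Qed.

Lemma continuous_gaussF : continuous gaussF.
Proof. by move=> z; apply: differentiable_continuous; apply/derivable1_diffP. Qed.

(** The sum of [gaussF y] and [gaussF (- y)] has zero derivative and tends to 1. *)
Lemma gaussF_opp x : gaussF (- x) = 1 - gaussF x.
Proof.
pose g y := gaussF y + gaussF (- y).
have gx y : g y = g x.
  apply: is_derive_0_is_cst => z; rewrite /g.
  have dN : is_derive z 1 (fun y => gaussF (- y)) (- gaussd z).
    have -> : - gaussd z = gaussd (- z) * -1 by rewrite /gaussd sqrrN mulrN1.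
    by apply: (@is_derive1_comp _ gaussF -%R).
  by have := is_deriveD (is_derive_gaussF z) dN; rewrite subrr.
have g1 : g y @[y --> +oo] --> (1 + 0 : R).
  rewrite /g; apply: cvgD; first exact: gaussF_cvgy.
  apply: (@cvg_comp _ _ _ -%R gaussF _ -oo); last exact: gaussF_cvgNy.
  by rewrite cvgNrNy; exact: cvg_id.
have gc : g y @[y --> +oo] --> g x.
  by apply: cvg_near_cst; apply: nearW => y; rewrite gx.
have <- : g x = 1 by rewrite (cvg_unique _ gc g1) ?addr0//; exact: Rhausdorff.
by rewrite /g addrAC subrr add0r.
Qed.

Lemma gaussF_lt1 x : gaussF x < 1.
Proof. by have := gaussF_gt0 (- x); rewrite gaussF_opp subr_gt0. Qed.
End gaussian.

(** * Gaussian tails *)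

Section tails.
Context {R : realType}.
Implicit Types x y z : R.
Local Notation gaussF := (@gaussF R).

(** Derivatives are produced by lemmas about sums and compositions of functions;
    this restates them for a function given pointwise and a simplified value. *)
Lemma is_derive_ext (f g : R -> R) x (df dg : R) :
  is_derive x 1 f df -> f =1 g -> df = dg -> is_derive x 1 g dg.
Proof. by move=> + /funext <- <-. Qed.

Lemma is_derive_gaussian z :
  is_derive z 1 (fun s : R => expR (- s ^+ 2 / 4)) (- (z / 2) * expR (- z ^+ 2 / 4)).
Proof.
have -> : - (z / 2) * expR (- z ^+ 2 / 4) = expR (- z ^+ 2 / 4) * - (z / 2).
  by rewrite mulrC.
apply: (@is_derive1_comp _ expR (fun s : R => - s ^+ 2 / 4)).
have h := is_deriveZ (- 4^-1) (is_deriveX 2 (is_derive_id z (1 : R))).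
apply: is_derive_ext h _ _ => [s|].
  by rewrite -[LHS]/(- 4^-1 * s ^+ 2); field.
by rewrite -[LHS]/(- 4^-1 * (2 * z ^+ 1 * 1)); field.
Qed.

Lemma cvgNy_gaussian : expR (- s ^+ 2 / 4) @[s --> -oo] --> (0 : R).
Proof.
apply: (@squeeze_cvgr _ _ _ _ (cst 0) (fun s : R => 4 * (- s)^-1)).
- near=> s; rewrite expR_ge0/=.
  have s0 : 1 < - s by rewrite ltrNr; near: s; apply: nbhs_ninfty_lt; rewrite num_real.
  have e1 : 1 + s ^+ 2 / 4 <= expR (s ^+ 2 / 4) := expR_ge1Dx _.
  rewrite mulNr expRN -[leLHS]mul1r ler_pdivrMr ?expR_gt0//.
  apply: le_trans (_ : 4 * (- s)^-1 * (1 + s ^+ 2 / 4) <= _); last first.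
    by rewrite ler_pM2l// mulr_gt0 ?invr_gt0//; lra.
  rewrite mulrAC ler_pdivlMr; last lra.
  nra.
- exact: cvg_cst.
- rewrite -[X in _ --> X](mulr0 4); apply: cvgM; first exact: cvg_cst.
  apply/gtr0_cvgV0; last by rewrite cvgNry; exact: cvg_id.
  near=> s; rewrite oppr_gt0; near: s; apply: nbhs_ninfty_lt; rewrite num_real.
Unshelve. all: by end_near. Qed.

(** Below [y] the right-hand side, with [y] frozen in the denominator, grows faster
    than [gaussF], since the ratio of the derivatives at [z] is [z / y >= 1]; both
    functions vanish at minus infinity. *)
Lemma gaussF_tail y : y < 0 -> gaussF y <= 2 * gaussc / (- y) * expR (- y ^+ 2 / 4).
Proof.
move=> y0; pose f z := 2 * gaussc / (- y) * expR (- z ^+ 2 / 4) - gaussF z.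
rewrite -subr_ge0 -[leRHS]/(f y).
have df z : is_derive z 1 f (gaussc * expR (- z ^+ 2 / 4) * (z / y - 1)).
  have := is_deriveB (is_deriveZ (2 * gaussc / (- y)) (is_derive_gaussian z)) (is_derive_gaussF z).
  move=> h; apply: is_derive_eq h _.
  by rewrite /GRing.scale /= /gaussd; field; rewrite lt_eqF.
have f0 : f z @[z --> -oo] --> (0 : R).
  rewrite -[X in _ --> X](subr0 0) -[X in _ --> X - _](mulr0 (2 * gaussc / (- y))).
  apply: cvgB; last exact: gaussF_cvgNy.
  by apply: cvgM; [exact: cvg_cst|]; exact: cvgNy_gaussian.
apply: (cvgr_to_le f0); near=> z.
apply: (@ger0_derive1_ndecrNy _ f y) => //.
- move=> s; rewrite in_itv/= => sy; rewrite derive1E derive_val.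
  rewrite mulr_ge0 ?mulr_ge0 ?expR_ge0 ?(ltW gaussc_gt0)//.
  by rewrite subr_ge0 ler_ndivlMr// mul1r ltW.
- apply: continuous_subspaceT => s; apply: differentiable_continuous.
  by apply/derivable1_diffP.
Unshelve. all: by end_near. Qed.

Lemma gaussF0 : gaussF 0 = 1 / 2.
Proof. have := @gaussF_opp R 0; rewrite oppr0; lra. Qed.

(** The tail bound suffices up to -1; from there on [gaussF] is at most 1/2 and the
    exponential at least 3/4. *)
Lemma gaussF_le_expR y : y <= 0 -> gaussF y <= expR (- y ^+ 2 / 4).
Proof.
move=> y0; have [y1|y1] := leP y (-1).
  apply: le_trans (gaussF_tail _) _; first lra.
  rewrite ler_piMl ?expR_ge0// ler_pdivrMr; last lra.
  have := @gaussc_le_half R; lra.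
apply: le_trans (_ : 1 / 2 <= _).
  by rewrite -gaussF0; move: y0; rewrite le_eqVlt => /predU1P[->//|/gaussF_lt/ltW].
by apply: le_trans (expR_ge1Dx _); nra.
Qed.

Definition sqneg y := Num.min y 0 ^+ 2.
Definition sqpos x := Num.max x 0 ^+ 2.

(** By the mean value theorem, the squares being those of the point of the interval
    closest to 0. *)
Lemma gaussF_sub_le x y : x < y ->
  gaussF y - gaussF x <= gaussc * (y - x) * expR (- (sqneg y + sqpos x) / 4).
Proof.
move=> xy; have [|z] := @MVT _ gaussF gaussd x y xy _.
  by apply: continuous_subspaceT => z; exact: continuous_gaussF.
rewrite in_itv/= => /andP[xz zy] ->; rewrite /gaussd mulrAC.
rewrite ler_pM2l ?mulr_gt0 ?gaussc_gt0 ?subr_gt0// ler_expR.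
rewrite ler_pM2r// lerN2 /sqneg /sqpos minEle maxEle.
by case: ifP => y0; case: ifP => x0; nra.
Qed.
End tails.

(** * Gaussian mass of intervals with extended real endpoints *)

Section ereal_mass.
Context {R : realType}.
Implicit Types y z : \bar R.

Definition esqneg z : R := if z is r%:E then sqneg r else 0.
Definition esqpos z : R := if z is r%:E then sqpos r else 0.

Lemma esqneg_ge0 z : 0 <= esqneg z.
Proof. by case: z => [r||] //=; exact: sqr_ge0. Qed.

Lemma esqpos_ge0 z : 0 <= esqpos z.
Proof. by case: z => [r||] //=; exact: sqr_ge0. Qed.

Lemma sqnegDpos (r : R) : sqneg r + sqpos r = r ^+ 2.
Proof. by rewrite /sqneg /sqpos minEle maxEle; case: ifP => _; ring. Qed.

Lemma esqneg_scale z (c : R) : 0 < c ->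
  esqneg (z * (c^-1)%:E)%E = esqneg z / c ^+ 2.
Proof.
move=> c0; case: z => [r||] /=.
- rewrite /sqneg -[in LHS](mul0r c^-1) -minr_pMl ?invr_ge0 ?ltW//.
  by rewrite exprMn exprVn.
- by rewrite gt0_mulye ?lte_fin ?invr_gt0// mul0r.
- by rewrite gt0_mulNye ?lte_fin ?invr_gt0// mul0r.
Qed.

Lemma esqpos_scale z (c : R) : 0 < c ->
  esqpos (z * (c^-1)%:E)%E = esqpos z / c ^+ 2.
Proof.
move=> c0; case: z => [r||] /=.
- rewrite /sqpos -[in LHS](mul0r c^-1) -maxr_pMl ?invr_ge0 ?ltW//.
  by rewrite exprMn exprVn.
- by rewrite gt0_mulye ?lte_fin ?invr_gt0// mul0r.
- by rewrite gt0_mulNye ?lte_fin ?invr_gt0// mul0r.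
Qed.

Lemma heatF_lt y z : (y < z)%E -> heatF y < heatF z.
Proof.
case: y => [r||]; case: z => [s||] //=; rewrite ?lte_fin => h.
- exact: gaussF_lt.
- exact: gaussF_lt1.
- exact: gaussF_gt0.
Qed.

Lemma heatF_ge0 z : 0 <= heatF z.
Proof. by case: z => [r||] //=; exact/ltW/gaussF_gt0. Qed.

Lemma heatF_le1 z : heatF z <= 1.
Proof. by case: z => [r||] //=; exact/ltW/gaussF_lt1. Qed.

Lemma heatF_le_expR z : heatF z <= expR (- esqneg z / 4).
Proof.
case: z => [r||] /=; rewrite ?oppr0 ?mul0r ?expR0 //.
rewrite /sqneg minEle; case: ifPn => r0; first exact: gaussF_le_expR.
by rewrite expr0n oppr0 mul0r expR0; exact/ltW/gaussF_lt1.
Qed.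

(** This symmetry transfers bounds near minus infinity to plus infinity. *)
Lemma heatF_opp z : heatF (- z)%E = 1 - heatF z.
Proof. by case: z => [r||] /=; rewrite ?subrr ?subr0//; exact: gaussF_opp. Qed.

Lemma esqneg_opp z : esqneg (- z)%E = esqpos z.
Proof.
by case: z => [r||] //=; rewrite /sqneg /sqpos -{1}oppr0 -oppr_max sqrrN.
Qed.

(** If [y] is at most 0 the mass is bounded by that of everything below [z], and
    otherwise by that of everything above [y]. *)
Lemma heatF_sub_le_expR y z : (y < z)%E ->
  heatF z - heatF y <= expR (- (esqneg z + esqpos y) / 4).
Proof.
move=> yz.
have [y0|y0] := leP y 0%E.
  have -> : esqpos y = 0.
    by case: y y0 {yz} => [r||] //=; rewrite lee_fin /sqpos => /max_idPr ->; rewrite expr0n.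
  rewrite addr0 (le_trans _ (heatF_le_expR z))// gerDl oppr_le0.
  exact: heatF_ge0.
have -> : esqneg z = 0.
  have z0 := ltW (lt_trans y0 yz).
  by case: z z0 {yz} => [r||] //=; rewrite lee_fin /sqneg => /min_idPr ->; rewrite expr0n.
rewrite add0r -esqneg_opp (le_trans _ (heatF_le_expR _))// heatF_opp.
by rewrite lerD2r heatF_le1.
Qed.
End ereal_mass.

(** * Summation by parts *)

Section abel.
Context {R : realType}.

Lemma abel_prefix_ge0 (n : nat) (c p : nat -> R) :
  (forall j, (1 <= j <= n)%N -> 0 <= \sum_(1 <= i < j.+1) c i) ->
  (forall i, (1 <= i <= n)%N -> 0 <= p i) ->
  (forall i, (1 <= i < n)%N -> p i.+1 <= p i) ->
  0 <= \sum_(1 <= i < n.+1) c i * p i.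
Proof.
move=> cs p0 pd; case: n => [|n] in cs p0 pd *; first by rewrite big_geq.
(* Replacing every factor [p i] by the last, smallest one only decreases the sum. *)
suff h m : (1 <= m.+1 <= n.+1)%N ->
    p m.+1 * \sum_(1 <= i < m.+2) c i <= \sum_(1 <= i < m.+2) c i * p i.
  by apply: le_trans (h n _); rewrite ?leqnn// mulr_ge0 ?p0 ?cs ?leqnn.
elim: m => [|m IH] mn; first by rewrite !big_nat1 mulrC.
rewrite big_nat_recr//= [leRHS]big_nat_recr//= mulrDr (mulrC (p m.+2) (c _)).
rewrite lerD2r (le_trans _ (IH _))//; last by rewrite /= ltnW.
by rewrite ler_wpM2r ?cs ?pd//= ltnW.
Qed.

Lemma abel_suffix_ge0 (n : nat) (c p : nat -> R) :
  (forall j, (1 <= j <= n)%N -> 0 <= \sum_(j <= i < n.+1) c i) ->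
  (forall i, (1 <= i <= n)%N -> 0 <= p i) ->
  (forall i, (1 <= i < n)%N -> p i <= p i.+1) ->
  0 <= \sum_(1 <= i < n.+1) c i * p i.
Proof.
move=> cs p0 pi; case: n => [|n] in cs p0 pi *; first by rewrite big_geq.
(* Replacing every factor [p i] by the first, smallest one only decreases the sum. *)
suff h m j : (0 < j)%N -> (j + m = n.+1)%N ->
    p j * \sum_(j <= i < n.+2) c i <= \sum_(j <= i < n.+2) c i * p i.
  by apply: le_trans (h n 1%N _ _); rewrite ?add1n// mulr_ge0 ?p0 ?cs.
elim: m => [|m IH] in j *.
  by rewrite addn0 => _ ->; rewrite !big_nat1 mulrC.
move=> j0 jm; have jn : (j < n.+1)%N by rewrite -jm addnS ltnS leq_addr.
rewrite big_ltn ?(leqW jn)// [leRHS]big_ltn ?(leqW jn)// mulrDr (mulrC (p j) (c _)).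
rewrite lerD2l (le_trans _ (IH j.+1 _ _))//; last by rewrite addSnnS.
by rewrite ler_wpM2r ?cs ?pi ?j0.
Qed.
End abel.

(** * The masses cut out by a vector of transition points *)

Section boundary.
Context {R : realType} (n : nat) (a : nat -> R).
Hypothesis a_gt0 : forall i, (i <= n)%N -> 0 < a i.
Implicit Types x : nat -> R.

Definition bnd x i j : R := heatF (xibar n x i * ((a j)^-1)%:E)%E.
Definition mass x i : R := bnd x i.+1 i - bnd x i i.
Definition incr x := forall i, (i <= n)%N -> (xibar n x i < xibar n x i.+1)%E.

Lemma xibar_mid x i : (1 <= i <= n)%N -> xibar n x i = (x i)%:E.
Proof. by case: i => [//|i] /= ni; rewrite /xibar /= ni. Qed.

Lemma xibar_top x : xibar n x n.+1 = +oo%E.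
Proof. by rewrite /xibar /= ltnn. Qed.

Lemma bnd0 x j : (j <= n)%N -> bnd x 0 j = 0.
Proof. by move=> jn; rewrite /bnd gt0_mulNye// lte_fin invr_gt0 a_gt0. Qed.

Lemma bnd_mid x i j : (1 <= i <= n)%N -> bnd x i j = gaussF (x i / a j).
Proof. by move=> hi; rewrite /bnd xibar_mid. Qed.

Lemma bnd_top x j : (j <= n)%N -> bnd x n.+1 j = 1.
Proof. by move=> jn; rewrite /bnd xibar_top gt0_mulye// lte_fin invr_gt0 a_gt0. Qed.

Lemma incrP x : incr x <-> (forall i, (1 <= i < n)%N -> x i < x i.+1).
Proof.
split=> [h i /andP[i1 iN]|h i].
  have := h i (ltnW iN); rewrite !xibar_mid ?lte_fin//.
  by rewrite i1 ltnW.
case: i => [|i] iN.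
  by rewrite /xibar /=; case: ifP => _; rewrite ?ltNyr ?ltNyy.
move: (iN); rewrite leq_eqVlt => /predU1P[e|iN'].
  by rewrite (xibar_mid x (i := i.+1)) ?iN// e xibar_top ltry.
by rewrite !xibar_mid ?lte_fin ?h.
Qed.

Lemma incr_le x i j : incr x -> (1 <= i)%N -> (i <= j <= n)%N -> x i <= x j.
Proof.
move=> /incrP xi i1 /andP[ij]; rewrite -(subnKC ij); elim: (j - i)%N => [|m IH].
  by rewrite addn0.
rewrite addnS => h; apply: le_trans (IH (ltnW h)) _; apply/ltW/xi.
by rewrite h andbT (leq_trans i1)// leq_addr.
Qed.

Lemma mass_gt0 x i : incr x -> (i <= n)%N -> 0 < mass x i.
Proof.
move=> xi iN; rewrite subr_gt0 heatF_lt//.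
by rewrite lte_pmul2r ?lte_fin ?invr_gt0 ?a_gt0//; exact: xi.
Qed.

(** The squared distance from 0 to the i-th interval, rescaled by [a i]: at most
    one of the two summands is nonzero. *)
Definition dist2 x i : R :=
  (esqneg (xibar n x i.+1) + esqpos (xibar n x i)) / a i ^+ 2.

Lemma mass_le_expR x i : incr x -> (i <= n)%N -> mass x i <= expR (- dist2 x i / 4).
Proof.
move=> xi iN; have ai := a_gt0 iN.
rewrite /dist2 mulrDl -esqneg_scale// -esqpos_scale//.
apply: heatF_sub_le_expR.
by rewrite lte_pmul2r ?lte_fin ?invr_gt0//; exact: xi.
Qed.

(** The amount by which the logarithm of the mass misses its Gaussian bound. *)
Definition defect x i : R := - ln (mass x i) - dist2 x i / 4.

Lemma defect_ge0 x i : incr x -> (i <= n)%N -> 0 <= defect x i.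
Proof.
move=> xi iN; rewrite subr_ge0 lerNr -mulNr.
by rewrite -[leRHS]expRK ler_ln ?posrE ?expR_gt0 ?mass_gt0// mass_le_expR.
Qed.

Lemma defect_le x i e : incr x -> (i <= n)%N -> defect x i <= e ->
  expR (- e) * expR (- dist2 x i / 4) <= mass x i.
Proof.
move=> xi iN; rewrite /defect => h.
rewrite -expRD -[leRHS]lnK ?posrE ?mass_gt0// ler_expR; lra.
Qed.

(** The tail bound carries a factor [a 0 / - x 1] that the exponential bound
    lacks, so a bounded defect keeps [x 1] from going to minus infinity. *)
Lemma defect_first x e : (1 <= n)%N -> incr x -> defect x 0 <= e ->
  - (2 * gaussc * a 0%N * expR e) <= x 1%N.
Proof.
move=> n1 xi /(defect_le xi (leq0n n)); have a0 := a_gt0 (leq0n n).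
rewrite /mass bnd0// subr0 bnd_mid// /dist2 xibar_mid//= addr0 expRN.
have [x0 _|x0] := leP 0 (x 1%N).
  by rewrite (le_trans _ x0)// oppr_le0 !mulr_ge0 ?expR_ge0 ?(ltW a0) ?(ltW gaussc_gt0).
have y0 : x 1%N / a 0%N < 0 by rewrite pmulr_llt0 ?invr_gt0.
move=> /le_trans/(_ (gaussF_tail y0)).
rewrite /sqneg (min_idPl (ltW x0)) exprMn exprVn -mulNr ler_pM2r ?expR_gt0// => h.
have {}h : - (x 1%N / a 0%N) <= 2 * gaussc * expR e.
  move: h; rewrite ler_pdivlMr ?oppr_gt0// mulrC ler_pdivrMr ?expR_gt0//.
rewrite lerNl (le_trans _ (_ : a 0%N * (2 * gaussc * expR e) <= _))//; last first.
  by rewrite le_eqVlt; apply/orP; left; apply/eqP; ring.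
by rewrite -ler_pdivrMl// mulrC mulNr.
Qed.

Lemma defect_last x e : (1 <= n)%N -> incr x -> defect x n <= e ->
  x n <= 2 * gaussc * a n * expR e.
Proof.
move=> n1 xi /(defect_le xi (leqnn n)); have a0 := a_gt0 (leqnn n).
rewrite /mass bnd_top// bnd_mid ?n1 ?leqnn// -gaussF_opp.
rewrite /dist2 xibar_top xibar_mid ?n1 ?leqnn//= add0r expRN.
have [x0 _|x0] := leP (x n) 0.
  by rewrite (le_trans x0)// !mulr_ge0 ?expR_ge0 ?(ltW a0) ?(ltW gaussc_gt0).
have y0 : - (x n / a n) < 0 by rewrite oppr_lt0 divr_gt0.
move=> /le_trans/(_ (gaussF_tail y0)).
rewrite /sqpos (max_idPl (ltW x0)) sqrrN opprK exprMn exprVn -mulNr.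
rewrite ler_pM2r ?expR_gt0// => h.
have {}h : x n / a n <= 2 * gaussc * expR e.
  move: h; rewrite ler_pdivlMr ?divr_gt0// mulrC ler_pdivrMr ?expR_gt0//.
rewrite (le_trans _ (_ : a n * (2 * gaussc * expR e) <= _))//; last first.
  by rewrite le_eqVlt; apply/orP; left; apply/eqP; ring.
by rewrite -ler_pdivrMl// mulrC.
Qed.

(** The density is at most its value at the point closest to 0, which the
    Gaussian factor cancels: a bounded defect keeps the interval from shrinking. *)
Lemma defect_mid x i e : incr x -> (1 <= i < n)%N -> defect x i <= e ->
  a i / (gaussc * expR e) <= x i.+1 - x i.
Proof.
move=> xi /andP[i1 iN]; have ai := a_gt0 (ltnW iN).
move=> /(defect_le xi (ltnW iN)).
have xx : x i < x i.+1 by move/incrP: xi; apply; rewrite i1.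
have xxa : x i / a i < x i.+1 / a i by rewrite ltr_pM2r ?invr_gt0.
have i1N : (1 <= i <= n)%N by rewrite i1 ltnW.
rewrite /mass !bnd_mid// => /le_trans/(_ (gaussF_sub_le xxa)).
rewrite /dist2 mulrDl !xibar_mid// -esqneg_scale// -esqpos_scale//=.
rewrite ler_pM2r ?expR_gt0// -mulrBl => h.
rewrite ler_pdivrMr ?mulr_gt0 ?expR_gt0 ?gaussc_gt0//.
move: h; rewrite expRN -[X in X <= _]div1r ler_pdivrMr ?expR_gt0// mulrA.
by rewrite mulrAC ler_pdivlMr// mul1r -mulrA mulrCA.
Qed.
End boundary.

(** * The energy and its minimizer *)

Section energy.
Context {R : realType} (n : nat) (a w d : nat -> R).
Hypothesis n_gt0 : (1 <= n)%N.
Hypothesis a_gt0 : forall i, (i <= n)%N -> 0 < a i.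
Hypothesis w_gt0 : forall i, (i <= n)%N -> 0 < w i.
Hypothesis prefix_ge0 : forall j, (1 <= j <= n)%N ->
  0 <= \sum_(1 <= i < j.+1) (w i.-1 / a i.-1 ^+ 2 + d i).
Hypothesis suffix_ge0 : forall j, (1 <= j <= n)%N ->
  0 <= \sum_(j <= i < n.+1) (w i / a i ^+ 2 + d i).
Implicit Types x : nat -> R.

Local Notation mass := (mass n a).
Local Notation defect := (defect n a).
Local Notation incr := (incr n).

Definition energy x : R :=
  \sum_(0 <= i < n.+1) - w i * ln (mass x i) +
  \sum_(1 <= i < n.+1) d i * (x i ^+ 2 / 4).

(** The quadratic part of the energy, once the masses have contributed their squared
    distances, splits into a sum over negative parts and one over positive parts,
    and both are nonnegative by summation by parts. *)
Lemma energy_ge_defect x : incr x ->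
  \sum_(0 <= i < n.+1) w i * defect x i <= energy x.
Proof.
move=> xi.
pose N i := esqneg (xibar n x i) / 4; pose P i := esqpos (xibar n x i) / 4.
have N0 i : 0 <= N i by rewrite divr_ge0// esqneg_ge0.
have P0 i : 0 <= P i by rewrite divr_ge0// esqpos_ge0.
have xmono i : (1 <= i < n)%N -> x i <= x i.+1.
  by move=> h; apply/ltW; move/incrP: xi; apply.
have SN : 0 <= \sum_(1 <= i < n.+1) (w i.-1 / a i.-1 ^+ 2 + d i) * N i.
  apply: abel_prefix_ge0 => // i /andP[i1 iN]; rewrite /N !xibar_mid ?i1 ?(ltnW iN)//=.
  have := xmono i; rewrite i1 iN => /(_ isT) xx.
  rewrite ler_pM2r// /sqneg !minEle; case: ifP => h1; case: ifP => h2; nra.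
have SP : 0 <= \sum_(1 <= i < n.+1) (w i / a i ^+ 2 + d i) * P i.
  apply: abel_suffix_ge0 => // i /andP[i1 iN]; rewrite /P !xibar_mid ?i1 ?(ltnW iN)//=.
  have := xmono i; rewrite i1 iN => /(_ isT) xx.
  rewrite ler_pM2r// /sqpos !maxEle; case: ifP => h1; case: ifP => h2; nra.
rewrite -subr_ge0 /energy (_ : _ - _ = \sum_(1 <= i < n.+1) (w i.-1 / a i.-1 ^+ 2 + d i) * N i
  + \sum_(1 <= i < n.+1) (w i / a i ^+ 2 + d i) * P i) ?addr_ge0//.
have -> : \sum_(0 <= i < n.+1) w i * defect x i =
    \sum_(0 <= i < n.+1) - w i * ln (mass x i) -
    (\sum_(0 <= i < n.+1) w i / a i ^+ 2 * N i.+1 +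
     \sum_(0 <= i < n.+1) w i / a i ^+ 2 * P i).
  rewrite -big_split -sumrB /=; apply: eq_bigr => i _.
  by rewrite /defect /dist2 /N /P; ring.
(* The negative part of the right endpoint of an interval is charged to that
   endpoint; the last endpoint is infinite and contributes 0. *)
have -> : \sum_(0 <= i < n.+1) w i / a i ^+ 2 * N i.+1 =
    \sum_(1 <= i < n.+1) w i.-1 / a i.-1 ^+ 2 * N i.
  rewrite big_nat_recr//= {2}/N xibar_top /= mul0r mulr0 addr0.
  by rewrite big_add1.
have -> : \sum_(0 <= i < n.+1) w i / a i ^+ 2 * P i =
    \sum_(1 <= i < n.+1) w i / a i ^+ 2 * P i.
  by rewrite big_ltn// /P /xibar /= mul0r mulr0 add0r.
have -> : \sum_(1 <= i < n.+1) d i * (x i ^+ 2 / 4) =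
    \sum_(1 <= i < n.+1) d i * N i + \sum_(1 <= i < n.+1) d i * P i.
  rewrite -big_split /=; apply: eq_big_nat => i hi.
  by rewrite /N /P !xibar_mid//= -sqnegDpos; ring.
under [X in _ = X + _]eq_bigr do rewrite mulrDl.
under [X in _ = _ + X]eq_bigr do rewrite mulrDl.
by rewrite !big_split /=; ring.
Qed.

Lemma energy_defect_le x M i : incr x -> energy x <= M -> (i <= n)%N ->
  defect x i <= M / w i.
Proof.
move=> xi EM iN; rewrite ler_pdivlMr ?w_gt0// mulrC.
apply: le_trans EM; apply: le_trans (energy_ge_defect xi).
rewrite big_mkord (bigD1 (Ordinal (iN : (i < n.+1)%N)))//= lerDl.
apply: sumr_ge0 => j _; have jn : (j <= n)%N by rewrite -ltnS.
by rewrite mulr_ge0 ?defect_ge0 ?ltW ?w_gt0.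
Qed.

(** Only the coordinates from 1 to n are read: a vector may be set to 0 elsewhere,
    which places it in a compact product. *)
Lemma eq_xibar x y i : (forall j, (1 <= j <= n)%N -> x j = y j) ->
  xibar n x i = xibar n y i.
Proof.
move=> xy; rewrite /xibar; case: ifP => // i0; case: ifP => // iN.
by rewrite xy// iN lt0n i0.
Qed.

Lemma eq_energy x y : (forall j, (1 <= j <= n)%N -> x j = y j) ->
  energy x = energy y.
Proof.
move=> xy; congr (_ + _); last by apply: eq_big_nat => i hi; rewrite xy.
by apply: eq_bigr => i _; rewrite /mass /bnd !(eq_xibar _ xy).
Qed.

Lemma cvg_sumr (T I : Type) (G : set_system T) {FG : Filter G} (r : seq I) (f : I -> T -> R)
    (l : I -> R) : (forall i, f i t @[t --> G] --> l i) ->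
  (\sum_(i <- r) f i t) @[t --> G] --> \sum_(i <- r) l i.
Proof. by move=> h; apply: cvg_big => //; exact: add_continuous. Qed.

Local Notation coords := (prod_topology (fun _ : nat => R)).

Lemma continuous_coord i : continuous (fun x : coords => x i : R).
Proof. exact: (@proj_continuous nat (fun=> R) i). Qed.

Lemma continuous_bnd i j x :
  {for x, continuous (fun x : coords => bnd n a x i j)}.
Proof.
rewrite /bnd /xibar; case: (i == 0%N); first exact: cst_continuous.
case: (i <= n)%N; last exact: cst_continuous.
rewrite /continuous_at.
apply: (@cvg_comp _ _ _ (fun y : coords => y i / a j) (@gaussF R)).
  exact: (cvgM (@continuous_coord i x) (cvg_cst _)).
exact: continuous_gaussF.
Qed.

Lemma continuous_energy x : incr x ->
  {for x, continuous (energy : coords -> R)}.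
Proof.
move=> xi.
have ck (k : R) : {for x, continuous (fun _ : coords => k)}.
  exact: cst_continuous.
have c1 (i : 'I_n.+1) : {for x, continuous (fun y : coords => - w i * ln (mass y i))}.
  have cm : {for x, continuous (fun y : coords => mass y i)}.
    exact: (cvgB (@continuous_bnd i.+1 i x) (@continuous_bnd i i x)).
  have xm : 0 < mass x i by apply: mass_gt0 => //; rewrite -ltnS.
  have cl : {for x, continuous (fun y : coords => ln (mass y i))}.
    exact: (@cvg_comp _ _ _ (fun y : coords => mass y i) (@ln R) _ _ _ cm
      (continuous_ln xm)).
  exact: (cvgM (ck (- w i)) cl).
have c2 (i : nat) : {for x, continuous (fun y : coords => d i * (y i ^+ 2 / 4))}.
  have cx := @continuous_coord i x.
  exact: (cvgM (ck (d i)) (cvgM (cvgM cx cx) (ck 4^-1))).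
have s1 := cvg_sumr (r := index_enum 'I_n.+1) (fun i => c1 i).
have s2 := cvg_sumr (r := index_iota 1 n.+1) (fun i => c2 i).
have s := cvgD (s1 _) (s2 _).
have e y : energy y = \sum_(i < n.+1) - w i * ln (mass y i) +
    \sum_(1 <= i < n.+1) d i * (y i ^+ 2 / 4) by rewrite /energy big_mkord.
have -> : energy = (fun y => \sum_(i < n.+1) - w i * ln (mass y i) +
    \sum_(1 <= i < n.+1) d i * (y i ^+ 2 / 4)) by apply/funext.
exact: s.
Qed.

Lemma energy_minimizer : exists x, incr x /\ forall y, incr y -> energy x <= energy y.
Proof.
pose x0 (i : nat) : R := i%:R.
have x0i : incr x0 by apply/incrP => i _; rewrite ltr_nat.
pose M := energy x0.
pose C := Num.max (2 * gaussc * a 0%N * expR (M / w 0%N))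
                  (2 * gaussc * a n * expR (M / w n)).
pose g i := a i / (gaussc * expR (M / w i)).
pose A i : set R := if (1 <= i <= n)%N then `[- C, C]%classic else [set 0].
pose B : set coords :=
  \bigcap_(i in [set i | (1 <= i < n)%N])
    ((fun f : coords => f i.+1 - f i) @^-1` [set y | g i <= y]).
(* Increasing vectors of energy at most [M] lie, up to the coordinates that are
   not read, in the compact set [K] of vectors in a box with gaps bounded below;
   the constants are those of the defect bounds. *)
pose K := [set f : coords | forall i, A i (f i)] `&` B.
have cK : compact K.
  apply: compact_closedI.
    apply: tychonoff => i; rewrite /A; case: ifP => _; first exact: segment_compact.
    exact: compact_set1.
  apply: closed_bigI => i _; apply: closed_comp; last exact: closed_ge.
  move=> f _; exact: (cvgB (@continuous_coord i.+1 f) (@continuous_coord i f)).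
have Ki f : K f -> incr f.
  move=> [_ fB]; apply/incrP => i hi; rewrite -subr_gt0.
  apply: lt_le_trans (fB i hi); move/andP: hi => [_ iN].
  by rewrite divr_gt0 ?mulr_gt0 ?gaussc_gt0 ?expR_gt0 ?a_gt0// ltnW.
pose trunc x i := if (1 <= i <= n)%N then x i else 0.
have tE x j : (1 <= j <= n)%N -> x j = trunc x j by rewrite /trunc => ->.
have xK x : incr x -> energy x <= M -> K (trunc x).
  move=> xi EM; split=> [i|i /andP[i1 iN]] /=.
    rewrite /A /trunc; case: ifP => [/andP[i1 iN]|//] /=; rewrite in_itv/=.
    have h1 := defect_first a_gt0 n_gt0 xi (energy_defect_le xi EM (leq0n n)).
    have h2 := defect_last a_gt0 n_gt0 xi (energy_defect_le xi EM (leqnn n)).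
    apply/andP; split.
      apply: le_trans (incr_le xi (leqnn 1) _); last by rewrite i1.
      by apply: le_trans h1; rewrite lerN2 le_max lexx.
    apply: le_trans (incr_le xi i1 (_ : (i <= n <= n)%N)) _; first by rewrite iN leqnn.
    by apply: le_trans h2 _; rewrite le_max lexx orbT.
  rewrite -!tE ?i1 ?(ltnW iN)//.
  apply: (defect_mid a_gt0 xi _ (energy_defect_le xi EM (ltnW iN))).
  by rewrite i1.
have [||x /set_mem xKx xmin] := @compact_EVT_min coords R energy K _ cK.
- by exists (trunc x0); exact: xK.
- apply: continuous_in_subspaceT => f /set_mem fK; exact: continuous_energy (Ki _ fK).
exists x; split; first exact: Ki.
move=> y yi; have [yM|/ltW My] := leP (energy y) M.
  by rewrite (eq_energy (tE y)); apply/xmin/mem_set/xK.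
apply: le_trans My; rewrite /M (eq_energy (tE x0)); exact/xmin/mem_set/xK.
Qed.
End energy.

(** * The Euler-Lagrange equations *)

Section derivatives.
Context {R : realType}.

Lemma is_derive_gaussF_scale (c s : R) :
  is_derive s 1 (fun y => gaussF (y / c)) (gaussd (s / c) / c).
Proof.
have h : is_derive s 1 (fun y => y / c) c^-1.
  apply: is_derive_ext (is_deriveZ c^-1 (is_derive_id s (1 : R))) _ _.
    by move=> y; rewrite -[LHS]/(c^-1 * y) mulrC.
  by rewrite -[LHS]/(c^-1 * 1) mulr1.
exact: (@is_derive1_comp _ (@gaussF R) (fun y => y / c)).
Qed.

Lemma is_derive_ln_comp (f : R -> R) (s df : R) : 0 < f s ->
  is_derive s 1 f df -> is_derive s 1 (fun y => ln (f y)) (df / f s).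
Proof.
move=> f0 h; rewrite mulrC; have := is_derive1_ln f0 => ?.
exact: (@is_derive1_comp _ (@ln R) f).
Qed.

Lemma is_derive_scale (f : R -> R) (s c df : R) :
  is_derive s 1 f df -> is_derive s 1 (fun y => c * f y) (c * df).
Proof. by move=> h; exact: (is_deriveZ c h). Qed.

Lemma is_derive_sqr4 (s : R) : is_derive s 1 (fun y => y ^+ 2 / 4) (s / 2).
Proof.
apply: is_derive_ext (is_derive_scale 4^-1 (is_deriveX 2 (is_derive_id s (1 : R)))) _ _.
  by move=> y; rewrite mulrC.
by rewrite -[LHS]/(4^-1 * (2 * s ^+ 1 * 1)); field.
Qed.
End derivatives.

Section critical.
Context {R : realType} (n : nat) (a w d : nat -> R).
Hypothesis a_gt0 : forall i, (i <= n)%N -> 0 < a i.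
Implicit Types x : nat -> R.

Local Notation bnd := (bnd n a).
Local Notation mass := (mass n a).
Local Notation incr := (incr n).
Local Notation energy := (energy n a w d).

Definition upd x i (s : R) : nat -> R := fun j => if j == i then s else x j.

Lemma updE x i s : upd x i s i = s. Proof. by rewrite /upd eqxx. Qed.

Lemma bnd_upd x i s j l : j != i -> bnd (upd x i s) j l = bnd x j l.
Proof. by move=> ji; rewrite /bnd /xibar /upd (negbTE ji). Qed.

(** As a function of one transition point, the energy only varies through the two
    adjacent intervals and one quadratic term. *)
Lemma energy_upd x i : (i < n)%N -> exists r : R, forall s,
  energy (upd x i.+1 s) =
    - w i * ln (gaussF (s / a i) - bnd x i i)
    + - w i.+1 * ln (bnd x i.+2 i.+1 - gaussF (s / a i.+1))
    + d i.+1 * (s ^+ 2 / 4) + r.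
Proof.
move=> iN.
exists (\sum_(0 <= j < i) - w j * ln (mass x j)
   + \sum_(i.+2 <= j < n.+1) - w j * ln (mass x j)
   + (\sum_(1 <= j < i.+1) d j * (x j ^+ 2 / 4)
   + \sum_(i.+2 <= j < n.+1) d j * (x j ^+ 2 / 4))) => s.
rewrite /energy (@big_cat_nat _ _ _ i 0%N)//=; last by rewrite ltnW// ltnW.
rewrite (@big_ltn _ _ _ i n.+1) ?(leqW iN)// (@big_ltn _ _ _ i.+1 n.+1)//.
rewrite (@big_cat_nat _ _ _ i.+1 1%N)//=; last by rewrite ltnW.
rewrite (@big_ltn _ _ _ i.+1 n.+1)// updE.
have low j : (0 <= j < i)%N -> - w j * ln (mass (upd x i.+1 s) j) = - w j * ln (mass x j).
  by move=> /andP[_ ji]; rewrite /mass !bnd_upd//; lia.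
have high j : (i.+2 <= j < n.+1)%N ->
    - w j * ln (mass (upd x i.+1 s) j) = - w j * ln (mass x j).
  by move=> /andP[ij _]; rewrite /mass !bnd_upd//; lia.
rewrite (eq_big_nat _ _ low) (eq_big_nat _ _ high).
have dlow j : (1 <= j < i.+1)%N -> d j * (upd x i.+1 s j ^+ 2 / 4) = d j * (x j ^+ 2 / 4).
  by move=> /andP[_ ji]; rewrite /upd (_ : (j == i.+1) = false)//; lia.
have dhigh j : (i.+2 <= j < n.+1)%N ->
    d j * (upd x i.+1 s j ^+ 2 / 4) = d j * (x j ^+ 2 / 4).
  by move=> /andP[ji _]; rewrite /upd (_ : (j == i.+1) = false)//; lia.
rewrite (eq_big_nat _ _ dlow) (eq_big_nat _ _ dhigh).
have mi : mass (upd x i.+1 s) i = gaussF (s / a i) - bnd x i i.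
  by rewrite /mass bnd_mid// updE bnd_upd//; lia.
have mi1 : mass (upd x i.+1 s) i.+1 = bnd x i.+2 i.+1 - gaussF (s / a i.+1).
  by rewrite /mass (bnd_mid a (upd x i.+1 s) (i := i.+1))// updE bnd_upd//; lia.
by rewrite mi mi1; ring.
Qed.

Lemma incr_upd x i s : incr x -> (i < n)%N ->
  ((0 < i)%N -> x i < s) -> ((i.+1 < n)%N -> s < x i.+2) -> incr (upd x i.+1 s).
Proof.
move=> /incrP xi iN lo hi; apply/incrP => j /andP[j1 jN]; rewrite /upd eqSS.
have [ej|ji] := eqVneq j i.+1.
  by subst j; rewrite (_ : (i.+1 == i) = false) ?hi//; lia.
have [ji'|ji'] := eqVneq j i; first by rewrite ji' lo// -ji'.
by rewrite xi// j1.
Qed.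

Lemma energy_critical x i : incr x -> (forall y, incr y -> energy x <= energy y) ->
  (i < n)%N ->
  w i.+1 * (gaussd (x i.+1 / a i.+1) / a i.+1 / mass x i.+1)
  - w i * (gaussd (x i.+1 / a i) / a i / mass x i) + d i.+1 * (x i.+1 / 2) = 0.
Proof.
move=> xi xmin iN; have [r er] := energy_upd x iN.
pose phi s := - w i * ln (gaussF (s / a i) - bnd x i i)
    + - w i.+1 * ln (bnd x i.+2 i.+1 - gaussF (s / a i.+1)) + d i.+1 * (s ^+ 2 / 4).
(* The neighbours of the transition point delimit the interval in which it may move;
   where there is none, any bound will do. *)
pose lo := if (0 < i)%N then x i else x i.+1 - 1.
pose hi := if (i.+1 < n)%N then x i.+2 else x i.+1 + 1.
have xlo : lo < x i.+1.
  rewrite /lo; case: ifP => i0; last by rewrite ltrBlDr ltrDl.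
  by move/incrP: xi; apply; rewrite i0.
have xhi : x i.+1 < hi.
  rewrite /hi; case: ifP => i0; last by rewrite ltrDl.
  by move/incrP: xi; apply.
have xin : x i.+1 \in `]lo, hi[ by rewrite in_itv/= xlo.
have incrs s : s \in `]lo, hi[ -> incr (upd x i.+1 s).
  rewrite in_itv/= => /andP[los shi]; apply: incr_upd => // h.
    by move: los; rewrite /lo h.
  by move: shi; rewrite /hi h.
have mi s : mass (upd x i.+1 s) i = gaussF (s / a i) - bnd x i i.
  by rewrite /mass bnd_mid// updE bnd_upd//; lia.
have mi1 s : mass (upd x i.+1 s) i.+1 = bnd x i.+2 i.+1 - gaussF (s / a i.+1).
  by rewrite /mass (bnd_mid a (upd x i.+1 s) (i := i.+1))// updE bnd_upd//; lia.
have dphi s : s \in `]lo, hi[ -> is_derive s 1 phi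
   (- w i * (gaussd (s / a i) / a i / mass (upd x i.+1 s) i)
    + - w i.+1 * (- (gaussd (s / a i.+1) / a i.+1) / mass (upd x i.+1 s) i.+1)
    + d i.+1 * (s / 2)).
  move=> /incrs si; have m0 := mass_gt0 a_gt0 si (ltnW iN).
  have m1 := mass_gt0 a_gt0 si iN; rewrite mi in m0; rewrite mi1 in m1.
  rewrite mi mi1.
  have e1 : is_derive s 1 (fun y => gaussF (y / a i) - bnd x i i) (gaussd (s / a i) / a i).
    apply: is_derive_ext (is_deriveB (is_derive_gaussF_scale (a i) s)
      (is_derive_cst (bnd x i i) s (1 : R))) _ _ => //.
    by rewrite subr0.
  have e2 : is_derive s 1 (fun y => bnd x i.+2 i.+1 - gaussF (y / a i.+1))
      (- (gaussd (s / a i.+1) / a i.+1)).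
    apply: is_derive_ext (is_deriveB (is_derive_cst (bnd x i.+2 i.+1) s (1 : R))
      (is_derive_gaussF_scale (a i.+1) s)) _ _ => //.
    by rewrite sub0r.
  have e3 := is_derive_scale (- w i)
    (@is_derive_ln_comp _ (fun y => gaussF (y / a i) - bnd x i i) s _ m0 e1).
  have e4 := is_derive_scale (- w i.+1)
    (@is_derive_ln_comp _ (fun y => bnd x i.+2 i.+1 - gaussF (y / a i.+1)) s _ m1 e2).
  exact: (is_deriveD (is_deriveD e3 e4) (is_derive_scale _ (is_derive_sqr4 s))).
have xE : upd x i.+1 (x i.+1) = x.
  by apply/funext => j; rewrite /upd; case: eqVneq => [->|].
have /@derive_val p0 : is_derive (x i.+1) 1 phi 0.
  apply: (@derive1_at_min _ phi lo hi) => //.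
  - exact/ltW/(lt_trans xlo).
  - by move=> s /dphi [].
  - move=> s /incrs /xmin; rewrite -{1}xE !er lerD2r; exact.
have /@derive_val := dphi _ xin; rewrite p0 xE => e.
by rewrite [RHS]e; ring.
Qed.
End critical.

(** * The temperature profile *)

Section profile.
Context {R : realType} (n : nat) (ut a : nat -> R) (x : nat -> R).
Hypothesis ut_lt : forall i, (i <= n)%N -> ut i < ut i.+1.
Hypothesis a_gt0 : forall i, (i <= n)%N -> 0 < a i.
Hypothesis x_incr : incr n x.

Local Notation bnd := (bnd n a x).
Local Notation mass := (mass n a x).
Local Notation xibar := (xibar n x).

Let mass_gt0 i : (i <= n)%N -> 0 < mass i.
Proof. exact: mass_gt0. Qed.

(** Projection onto the i-th interval; the first and the last one are half-lines. *)
Definition clamp i (z : R) : R :=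
  let y := if i == 0%N then z else Num.max z (x i) in
  if i == n then y else Num.min y (x i.+1).

Definition progress i (z : R) : R := (gaussF (clamp i z / a i) - bnd i i) / mass i.

(** A sum of ramps, the i-th one climbing from 0 to 1 across the i-th interval:
    continuity and monotonicity hold termwise, with no gluing of pieces. *)
Definition profile (z : R) : R :=
  ut 0%N + \sum_(0 <= i < n.+1) (ut i.+1 - ut i) * progress i z.

Definition piece i (z : R) : R :=
  ut i + (ut i.+1 - ut i) / mass i * (gaussF (z / a i) - bnd i i).

Lemma xibar_le i j : (i <= j <= n.+1)%N -> (xibar i <= xibar j)%E.
Proof.
move=> /andP[ij]; rewrite -(subnKC ij); elim: (j - i)%N => [|m IH].
  by rewrite addn0.
rewrite addnS => h; apply: le_trans (IH (ltnW h)) _; apply/ltW/x_incr.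
by rewrite -ltnS.
Qed.

Lemma clamp_id i z : (i <= n)%N -> (xibar i <= z%:E <= xibar i.+1)%E ->
  clamp i z = z.
Proof.
move=> iN /andP[h1 h2]; rewrite /clamp.
have -> : (if i == 0%N then z else Num.max z (x i)) = z.
  case: eqVneq => // i0; apply/max_idPl.
  by move: h1; rewrite xibar_mid ?lee_fin// lt0n i0.
case: eqVneq => // i0; apply/min_idPl.
by move: h2; rewrite xibar_mid ?lee_fin//; lia.
Qed.

Lemma progress_left i z : (i <= n)%N -> (z%:E <= xibar i)%E -> progress i z = 0.
Proof.
move=> iN; case: i => [|i] // in iN *.
rewrite xibar_mid// lee_fin => zx.
rewrite /progress /clamp /= (max_idPr zx).
have -> : (if i.+1 == n then x i.+1 else Num.min (x i.+1) (x i.+2)) = x i.+1.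
  case: eqVneq => // i0; apply/min_idPl/ltW.
  by move/incrP: x_incr; apply; lia.
by rewrite bnd_mid// subrr mul0r.
Qed.

Lemma progress_right i z : (i <= n)%N -> (xibar i.+1 <= z%:E)%E -> progress i z = 1.
Proof.
move=> iN; have [->|i0] := eqVneq i n; first by rewrite xibar_top leye_eq.
rewrite xibar_mid ?lee_fin => [zx|]; last by lia.
rewrite /progress /clamp (negbTE i0).
set y := (if i == 0%N then z else _).
have yx : x i.+1 <= y.
  by rewrite /y; case: ifP => // _; rewrite le_max zx.
rewrite (min_idPr yx) -(bnd_mid a x (n := n)); last by lia.
by rewrite -/(mass i) divff// gt_eqF// mass_gt0.
Qed.

(** On the i-th interval the earlier ramps are complete and their increments
    telescope to [ut i - ut 0], while the later ramps have not started. *)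
Lemma profile_piece i z : (i <= n)%N -> (xibar i <= z%:E <= xibar i.+1)%E ->
  profile z = piece i z.
Proof.
move=> iN h; rewrite /profile (@big_cat_nat _ _ _ i 0%N)//=; last exact: leqW.
rewrite (@big_ltn _ _ _ i)//.
have low j : (0 <= j < i)%N -> (ut j.+1 - ut j) * progress j z = ut j.+1 - ut j.
  move=> /andP[_ ji]; rewrite progress_right ?mulr1//; first by lia.
  by case/andP: h => h _; apply: le_trans h; apply: xibar_le; lia.
rewrite (eq_big_nat _ _ low) telescope_sumr//.
rewrite [X in _ + (_ + (_ + X))]big1_seq => [|j].
  by rewrite /progress clamp_id// /piece; ring.
rewrite mem_index_iota => /andP[_ /andP[ij jn]]; rewrite progress_left ?mulr0//.
by case/andP: h => _ /le_trans; apply; apply: xibar_le; rewrite ij; exact: ltnW.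
Qed.

Lemma profile_le y z : y <= z -> profile y <= profile z.
Proof.
move=> yz; rewrite lerD2l; apply: ler_sum_nat => i /andP[_ iN].
have ai := a_gt0 iN; have ui := ut_lt iN; have mi := mass_gt0 iN.
rewrite ler_pM2l ?subr_gt0// ler_pM2r ?invr_gt0// lerD2r.
have cc : clamp i y <= clamp i z.
  rewrite /clamp; case: ifP => _; case: ifP => _ //.
  - by rewrite ge_max !le_max lexx yz orbT.
  - by rewrite le_min !ge_min lexx yz orbT.
  - by rewrite le_min !ge_min ge_max !le_max !lexx yz !orbT.
have : clamp i y / a i <= clamp i z / a i by rewrite ler_pM2r ?invr_gt0.
by rewrite le_eqVlt => /predU1P[->//|/gaussF_lt/ltW].
Qed.

Lemma continuous_profile : continuous profile.
Proof.
move=> z; apply: cvgD; first exact: cvg_cst.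
apply: cvg_sumr => i; apply: cvgM; first exact: cvg_cst.
apply: cvgM; last exact: cvg_cst.
apply: cvgB; last exact: cvg_cst.
apply: (@cvg_comp _ _ _ (fun y => clamp i y / a i) (@gaussF R)); last exact: continuous_gaussF.
apply: cvgM; last exact: cvg_cst.
have cid : {for z, continuous (id : R -> R)} by exact: cvg_id.
have cmx : {for z, continuous (fun y => Num.max y (x i))}.
  exact: (continuous_max cid (@cst_continuous _ _ (x i) z)).
rewrite /clamp; case: (i == 0%N); case: (i == n) => //.
- exact: (continuous_min cid (@cst_continuous _ _ (x i.+1) z)).
- exact: (continuous_min cmx (@cst_continuous _ _ (x i.+1) z)).
Qed.

Lemma profile_xi i : (1 <= i <= n)%N -> profile (x i) = ut i.
Proof.
move=> hi; have /andP[i1 iN] := hi.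
rewrite (@profile_piece i)//; last first.
  by rewrite -(xibar_mid x hi) lexx/= ltW//; exact: x_incr.
by rewrite /piece bnd_mid// subrr mulr0 addr0.
Qed.

(** By monotonicity, a level strictly between two transition temperatures is only
    reached strictly between the two transition points. *)
Lemma profile_lt_xibar i z : (i <= n)%N -> ut i < profile z < ut i.+1 ->
  (xibar i < z%:E < xibar i.+1)%E.
Proof.
move=> iN /andP[h1 h2]; apply/andP; split.
  case: i => [|i] in iN h1 {h2} *; first by rewrite /Defs.xibar /= ltNyr.
  rewrite xibar_mid// lte_fin ltNge; apply/negP => /profile_le.
  by rewrite profile_xi// leNgt h1.
have [->|i0] := eqVneq i n; first by rewrite xibar_top ltry.
have hi : (1 <= i.+1 <= n)%N by lia.
rewrite xibar_mid// lte_fin ltNge; apply/negP => /profile_le.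
by rewrite profile_xi// leNgt h2.
Qed.

Lemma near_gt_xibar i (z : R) : (xibar i < z%:E)%E ->
  \forall y \near z, (xibar i < y%:E)%E.
Proof.
case: (xibar i) => [r h|h|h]; last by apply: (@filterE _ (nbhs z)) => y; rewrite ltNyr.
  by apply: filterS (lt_nbhsr h) => y; rewrite lte_fin.
by rewrite ltNge leey in h.
Qed.

Lemma near_lt_xibar i (z : R) : (z%:E < xibar i)%E ->
  \forall y \near z, (y%:E < xibar i)%E.
Proof.
case: (xibar i) => [r h|h|h].
- by apply: filterS (lt_nbhsl h) => y; rewrite lte_fin.
- by apply: (@filterE _ (nbhs z)) => y; rewrite ltry.
- by rewrite ltNge leNye in h.
Qed.

Lemma near_in_xibar i (z : R) : (xibar i < z%:E < xibar i.+1)%E ->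
  \forall y \near z, (xibar i < y%:E < xibar i.+1)%E.
Proof.
move=> /andP[/near_gt_xibar l /near_lt_xibar r].
by apply: filterS2 l r => y yl yr; rewrite yl.
Qed.

Lemma profile_cvgNy : profile z @[z --> -oo] --> ut 0%N.
Proof.
apply: cvg_trans (_ : piece 0 z @[z --> -oo] --> ut 0%N).
  apply: near_eq_cvg; near=> z; apply/esym/profile_piece => //.
  apply/andP; split; first exact: leNye.
  rewrite /Defs.xibar /=; case: ifP => _; last exact: leey.
  by rewrite lee_fin.
rewrite -[X in _ --> X]addr0 -[X in _ --> _ + X](mulr0 ((ut 1%N - ut 0%N) / mass 0)).
apply: cvgD; first exact: cvg_cst.
apply: cvgM; first exact: cvg_cst.
rewrite bnd0// -[X in _ --> X](subr0 (0 : R)).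
apply: cvgB; last exact: cvg_cst.
apply: (@cvg_comp _ _ _ (fun z => z / a 0%N) (@gaussF R)); last exact: gaussF_cvgNy.
apply: gt0_cvgMlNy; first by rewrite invr_gt0 a_gt0.
exact: cvg_id.
Unshelve. all: by end_near. Qed.

Lemma profile_cvgy : profile z @[z --> +oo] --> ut n.+1.
Proof.
apply: cvg_trans (_ : piece n z @[z --> +oo] --> ut n.+1).
  apply: near_eq_cvg; near=> z; apply/esym/profile_piece => //.
  apply/andP; split; last by rewrite xibar_top leey.
  rewrite /Defs.xibar; case: ifP => _; first exact: leNye.
  by rewrite leqnn lee_fin.
have -> : ut n.+1 = ut n + (ut n.+1 - ut n) / mass n * (1 - bnd n n).
  rewrite -(@bnd_top _ n a a_gt0 x n)// -/(mass n) divfK ?gt_eqF ?mass_gt0//.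
  by rewrite addrC subrK.
apply: cvgD; first exact: cvg_cst.
apply: cvgM; first exact: cvg_cst.
apply: cvgB; last exact: cvg_cst.
apply: (@cvg_comp _ _ _ (fun z => z / a n) (@gaussF R)); last exact: gaussF_cvgy.
apply: gt0_cvgMly; first by rewrite invr_gt0 a_gt0.
exact: cvg_id.
Unshelve. all: by end_near. Qed.

End profile.

(** * The profile solves the Stefan problem *)

Section one_sided.
Context {R : realType}.
Implicit Types f g : R -> R.

Lemma is_derive_cvg g (x l : R) : is_derive x 1 g l ->
  h^-1 * (g (x + h) - g x) @[h --> 0^'] --> l.
Proof.
move=> [dg <-]; apply: cvg_trans dg; apply: near_eq_cvg; near=> h.
by rewrite -[LHS]/(h^-1 * (g (h * 1 + x) - g x)) mulr1 (addrC h).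
Unshelve. all: by end_near. Qed.

Let near_shift0 (P : R -> Prop) (x : R) : (\forall y \near x, P y) ->
  \forall h \near (0 : R), P (x + h).
Proof.
move=> Px; have cx : x + h @[h --> (0 : R)] --> x.
  by rewrite -[X in _ --> X](addr0 x); apply: cvgD; [exact: cvg_cst|exact: cvg_id].
exact: cx _ Px.
Qed.

Lemma right_derive_near g f (x l : R) : is_derive x 1 g l -> f x = g x ->
  (\forall y \near x, x < y -> f y = g y) -> is_right_derive f x l.
Proof.
move=> /is_derive_cvg dg fx fg; rewrite /is_right_derive.
have sub : (0 : R)^'+ `=>` 0^'.
  move=> A /= h0; rewrite /at_right /within /=.
  by apply: (@filterS _ (nbhs (0 : R)) _ _ _ _ h0) => u h u0; apply: h; rewrite gt_eqF.
apply: cvg_trans (cvg_trans (cvg_app _ sub) dg); apply: near_eq_cvg.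
rewrite /at_right; apply: filterS (near_shift0 fg) => h fgh h0.
by rewrite fgh ?fx// ltrDl.
Qed.

Lemma left_derive_near g f (x l : R) : is_derive x 1 g l -> f x = g x ->
  (\forall y \near x, y < x -> f y = g y) -> is_left_derive f x l.
Proof.
move=> /is_derive_cvg dg fx fg; rewrite /is_left_derive.
have sub : (0 : R)^'- `=>` 0^'.
  move=> A /= h0; rewrite /at_left /within /=.
  by apply: (@filterS _ (nbhs (0 : R)) _ _ _ _ h0) => u h u0; apply: h; rewrite lt_eqF.
apply: cvg_trans (cvg_trans (cvg_app _ sub) dg); apply: near_eq_cvg.
rewrite /at_left; apply: filterS (near_shift0 fg) => h fgh h0.
by rewrite fgh ?fx// gtrDl.
Qed.
End one_sided.

Section kernel.
Context {R : realType}.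

Lemma is_derive_gaussd (s : R) : is_derive s 1 gaussd (- (s / 2) * gaussd s).
Proof.
have := is_derive_scale gaussc (is_derive_gaussian s).
by rewrite /gaussd mulrCA.
Qed.

Lemma is_derive_div_sqrt (y t : R) : 0 < t ->
  is_derive t 1 (fun s => y / Num.sqrt s) (- (y / Num.sqrt t) / (2 * t)).
Proof.
move=> t0; have q0 : 0 < Num.sqrt t by rewrite sqrtr_gt0.
have h := is_derive_scale y (is_deriveV (lt0r_neq0 q0) (is_derive1_sqrt t0)).
apply: is_derive_ext h _ _ => //.
rewrite -[_ *: _]/(_ * _) -[in RHS](sqr_sqrtr (ltW t0)) sqrtr_sqr ger0_norm//.
by field; rewrite gt_eqF.
Qed.

End kernel.

Section verification.
Context {R : realType} (n : nat) (ut a k d : nat -> R) (x : nat -> R).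
Hypothesis ut_lt : forall i, (i <= n)%N -> ut i < ut i.+1.
Hypothesis a_gt0 : forall i, (i <= n)%N -> 0 < a i.
Hypothesis x_incr : incr n x.

Local Notation bnd := (bnd n a x).
Local Notation mass := (mass n a x).
Local Notation xibar := (xibar n x).
Local Notation profile := (profile n ut a x).
Local Notation piece := (piece n ut a x).

Definition selfsim (t y : R) : R := profile (y / Num.sqrt t).

Let slope i : R := (ut i.+1 - ut i) / mass i.

Lemma is_derive_piece i (z : R) :
  is_derive z 1 (piece i) (slope i * (gaussd (z / a i) / a i)).
Proof.
have h := is_deriveD (is_derive_cst (ut i) z (1 : R)) (is_derive_scale (slope i)
  (is_deriveB (is_derive_gaussF_scale (a i) z) (is_derive_cst (bnd i i) z (1 : R)))).
by apply: is_derive_ext h _ _ => //; rewrite add0r subr0.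
Qed.

Lemma is_derive_piece_space i (q y : R) :
  is_derive y 1 (fun y => piece i (y / q)) (slope i * (gaussd (y / q / a i) / a i) / q).
Proof.
have h : is_derive y 1 (fun y => y / q) q^-1.
  apply: is_derive_ext (is_derive_scale q^-1 (is_derive_id y (1 : R))) _ _.
    by move=> z; rewrite mulrC.
  by rewrite mulr1.
exact: (@is_derive1_comp _ (piece i) (fun y => y / q) y _ _ (is_derive_piece i (y / q)) h).
Qed.

(** Near the point the solution is an affine function of [gaussF (y / (a sqrt t))],
    whose equation follows from [gaussd' s = - s / 2 * gaussd s]. *)
Lemma heat_piece i (t y : R) : (i <= n)%N -> 0 < t ->
  (xibar i < (y / Num.sqrt t)%:E < xibar i.+1)%E ->
  heat_equation_at (a i) selfsim t y.
Proof.
move=> iN t0 yin; have q0 : 0 < Num.sqrt t by rewrite sqrtr_gt0.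
have ai := a_gt0 iN.
have nearS : \forall s \near t, piece i (y / Num.sqrt s) = selfsim s y.
  have ct : {for t, continuous (fun s => y / Num.sqrt s)}.
    apply: differentiable_continuous; apply/derivable1_diffP.
    by case: (is_derive_div_sqrt y t0).
  have ct' : \forall s \near t, (xibar i < (y / Num.sqrt s)%:E < xibar i.+1)%E.
    exact: ct _ (near_in_xibar yin).
  apply: filterS ct' => s /= /andP[/ltW h1 /ltW h2].
  by rewrite /selfsim (@profile_piece _ n ut a x a_gt0 x_incr i)// h1.
have nearY (z : R) : (xibar i < (z / Num.sqrt t)%:E < xibar i.+1)%E ->
    \forall y \near z, piece i (y / Num.sqrt t) = selfsim t y.
  move=> zin.
  have cz : {for z, continuous (fun y : R => y / Num.sqrt t)}.
    by apply: cvgM; [exact: cvg_id|exact: cvg_cst].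
  have cz' : \forall y \near z, (xibar i < (y / Num.sqrt t)%:E < xibar i.+1)%E.
    exact: cz _ (near_in_xibar zin).
  apply: filterS cz' => s /= /andP[/ltW h1 /ltW h2].
  by rewrite /selfsim (@profile_piece _ n ut a x a_gt0 x_incr i)// h1.
have openY : \forall z \near y, (xibar i < (z / Num.sqrt t)%:E < xibar i.+1)%E.
  have cy : {for y, continuous (fun y : R => y / Num.sqrt t)}.
    by apply: cvgM; [exact: cvg_id|exact: cvg_cst].
  exact: (cy _ (near_in_xibar yin)).
pose ux (z : R) := slope i * (gaussd (z / Num.sqrt t / a i) / a i) / Num.sqrt t.
have dY : \forall z \near y, is_derive (z : R) (1 : R) (selfsim t) (ux z).
  apply: filterS openY => z /nearY nz.
  exact: near_eq_is_derive nz (is_derive_piece_space i (Num.sqrt t) z).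
pose c := (Num.sqrt t * a i)^-1.
pose uxx := slope i * c * (- (y / Num.sqrt t / a i / 2) * gaussd (y / Num.sqrt t / a i) * c).
have dux : is_derive y 1 ux uxx.
  have dlin : is_derive y 1 (fun z : R => z / Num.sqrt t / a i) c.
    apply: is_derive_ext (is_derive_scale c (is_derive_id y (1 : R))) _ _.
      by move=> z; rewrite /c invfM mulrC mulrA.
    by rewrite mulr1.
  have dg := @is_derive1_comp _ gaussd (fun z : R => z / Num.sqrt t / a i) y _ _
    (is_derive_gaussd (y / Num.sqrt t / a i)) dlin.
  apply: is_derive_ext (is_derive_scale (slope i * c) dg) _ _ => // z.
  by rewrite /ux /c /= invfM; ring.
have duxx : is_derive y 1 (derive1 (selfsim t)) uxx.
  apply: near_eq_is_derive dux; apply: filterS dY => z hz.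
  by rewrite derive1E derive_val.
have dt : is_derive t 1 (fun s => selfsim s y)
   (slope i * (gaussd (y / Num.sqrt t / a i) / a i) * (- (y / Num.sqrt t) / (2 * t))).
  apply: near_eq_is_derive nearS _.
  exact: (@is_derive1_comp _ (piece i) (fun s => y / Num.sqrt s) t _ _
     (is_derive_piece i _) (is_derive_div_sqrt y t0)).
split.
- by case: dt.
- by apply: filterS dY => z [].
- by case: duxx.
- rewrite !derive1E (@derive_val _ _ _ _ _ _ _ dt) (@derive_val _ _ _ _ _ _ _ duxx).
  have tq : t = Num.sqrt t ^+ 2 by rewrite sqr_sqrtr// ltW.
  rewrite /uxx /c; move: (slope i) (gaussd _) => S G.
  move: (Num.sqrt t) tq q0 => q -> q0.
  by field; rewrite !gt_eqF.
Qed.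

Lemma selfsim_right_derive i (t : R) : (1 <= i <= n)%N -> 0 < t ->
  is_right_derive (selfsim t) (x i * Num.sqrt t)
    (slope i * (gaussd (x i / a i) / a i) / Num.sqrt t).
Proof.
move=> hi t0; have q0 : 0 < Num.sqrt t by rewrite sqrtr_gt0.
have /andP[i1 iN] := hi.
have := is_derive_piece_space i (Num.sqrt t) (x i * Num.sqrt t).
rewrite mulfK ?gt_eqF// => dg; apply: right_derive_near dg _ _.
  rewrite /selfsim mulfK ?gt_eqF// (@profile_piece _ n ut a x a_gt0 x_incr i)//.
  by rewrite -(xibar_mid x hi) lexx ltW// x_incr.
have cy : y / Num.sqrt t @[y --> x i * Num.sqrt t] --> x i.
  rewrite -[X in _ --> X](mulfK (lt0r_neq0 q0)).
  by apply: cvgM; [exact: cvg_id|exact: cvg_cst].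
have lt1 : \forall y \near x i * Num.sqrt t, ((y / Num.sqrt t)%:E < xibar i.+1)%E.
  by apply: (cy _ (near_lt_xibar _)); rewrite -(xibar_mid x hi) x_incr.
apply: filterS lt1 => y /ltW yx xy.
rewrite /selfsim (@profile_piece _ n ut a x a_gt0 x_incr i)// yx andbT.
by rewrite xibar_mid// lee_fin ler_pdivlMr// ltW.
Qed.

Lemma selfsim_left_derive i (t : R) : (i < n)%N -> 0 < t ->
  is_left_derive (selfsim t) (x i.+1 * Num.sqrt t)
    (slope i * (gaussd (x i.+1 / a i) / a i) / Num.sqrt t).
Proof.
move=> iN t0; have q0 : 0 < Num.sqrt t by rewrite sqrtr_gt0.
have hi : (1 <= i.+1 <= n)%N by [].
have := is_derive_piece_space i (Num.sqrt t) (x i.+1 * Num.sqrt t).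
rewrite mulfK ?gt_eqF// => dg; apply: left_derive_near dg _ _.
  rewrite /selfsim mulfK ?gt_eqF// (@profile_piece _ n ut a x a_gt0 x_incr i) ?(ltnW iN)//.
  by rewrite -(xibar_mid x hi) lexx ltW// x_incr// ltnW.
have cy : y / Num.sqrt t @[y --> x i.+1 * Num.sqrt t] --> x i.+1.
  rewrite -[X in _ --> X](mulfK (lt0r_neq0 q0)).
  by apply: cvgM; [exact: cvg_id|exact: cvg_cst].
have lt1 : \forall y \near x i.+1 * Num.sqrt t, (xibar i < (y / Num.sqrt t)%:E)%E.
  by apply: (cy _ (near_gt_xibar _)); rewrite -(xibar_mid x hi) x_incr// ltnW.
apply: filterS lt1 => y /ltW yx xy.
rewrite /selfsim (@profile_piece _ n ut a x a_gt0 x_incr i)// ?(ltnW iN)// yx/=.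
by rewrite xibar_mid// lee_fin ler_pdivrMr// ltW.
Qed.

(** All three terms of the Stefan condition carry the factor [1 / sqrt t]; what is
    left is the Euler-Lagrange equation. *)
Lemma stefan_selfsim i (t : R) : (i < n)%N -> 0 < t ->
  k i.+1 * (ut i.+2 - ut i.+1) * (gaussd (x i.+1 / a i.+1) / a i.+1 / mass i.+1)
  - k i * (ut i.+1 - ut i) * (gaussd (x i.+1 / a i) / a i / mass i)
  + d i.+1 * (x i.+1 / 2) = 0 ->
  stefan_condition_at (k i) (k i.+1) (d i.+1) selfsim (fun t => x i.+1 * Num.sqrt t) t.
Proof.
move=> iN t0 crit; have q0 : 0 < Num.sqrt t by rewrite sqrtr_gt0.
have dx := is_derive_scale (x i.+1) (is_derive1_sqrt t0).
split; first by case: dx.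
exists (slope i * (gaussd (x i.+1 / a i) / a i) / Num.sqrt t),
  (slope i.+1 * (gaussd (x i.+1 / a i.+1) / a i.+1) / Num.sqrt t); split.
- exact: selfsim_left_derive.
- exact: selfsim_right_derive.
rewrite derive1E (@derive_val _ _ _ _ _ _ _ dx) -[RHS](mul0r (Num.sqrt t)^-1) -crit /slope.
have -> : (2 * Num.sqrt t)^-1 = (Num.sqrt t)^-1 / 2 by rewrite invfM mulrC.
by ring.
Qed.

Let inv_sqrt_cvgy : (Num.sqrt t)^-1 @[t --> (0 : R)^'+] --> +oo.
Proof.
apply/cvgrVy; last first.
  rewrite -[X in _ --> X](sqrtr0 R); apply: cvg_at_right_filter; exact: sqrt_continuous.
by near=> t; rewrite sqrtr_gt0; near: t; exact: nbhs_right_gt.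
Unshelve. all: by end_near. Qed.

Lemma selfsim_cvg_left (y : R) : y < 0 -> selfsim t y @[t --> 0^'+] --> ut 0%N.
Proof.
move=> y0; apply: (@cvg_comp _ _ _ (fun t => y / Num.sqrt t) profile); last first.
  exact: profile_cvgNy.
apply/cvgNry.
have -> : - (fun t => y / Num.sqrt t) = (fun t => - y * (Num.sqrt t)^-1).
  by apply/funext => t; rewrite mulNr.
by apply: gt0_cvgMry; rewrite ?oppr_gt0.
Qed.

Lemma selfsim_cvg_right (y : R) : 0 < y -> selfsim t y @[t --> 0^'+] --> ut n.+1.
Proof.
move=> y0; apply: (@cvg_comp _ _ _ (fun t => y / Num.sqrt t) profile); last first.
  exact: profile_cvgy.
exact: gt0_cvgMry.
Qed.

End verification.

Theorem theorem2 (R : realType) (n : nat) (ut a k d : nat -> R)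
    (hn : (1 <= n)%N)
    (hut : forall i : nat, (i <= n)%N -> ut i < ut i.+1)
    (ha : forall i : nat, (i <= n)%N -> 0 < a i)
    (hk : forall i : nat, (i <= n)%N -> 0 < k i) :
  let kappa (i : nat) : R := k i / a i ^+ 2 in
  (forall j : nat, (1 <= j <= n)%N ->
     0 <= \sum_(1 <= i < j.+1) (kappa i.-1 * (ut i - ut i.-1) + d i) /\
     0 <= \sum_(j <= i < n.+1) (kappa i * (ut i.+1 - ut i) + d i)) ->
  exists u : R -> R -> R, self_similar_increasing_solution n ut a k d u.
Proof.
move=> kappa hsum; pose w i := k i * (ut i.+1 - ut i).
have w_gt0 i : (i <= n)%N -> 0 < w i.
  by move=> iN; rewrite mulr_gt0 ?hk ?subr_gt0 ?hut.
have pre j : (1 <= j <= n)%N ->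
    0 <= \sum_(1 <= i < j.+1) (w i.-1 / a i.-1 ^+ 2 + d i).
  move=> /hsum[h _]; move: h; congr (_ <= _); apply: eq_big_nat => i /andP[i1 _].
  by rewrite /w /kappa prednK// mulrAC.
have suf j : (1 <= j <= n)%N -> 0 <= \sum_(j <= i < n.+1) (w i / a i ^+ 2 + d i).
  move=> /hsum[_ h]; move: h; congr (_ <= _); apply: eq_bigr => i _.
  by rewrite /w /kappa mulrAC.
have [x [xi xmin]] := energy_minimizer hn ha w_gt0 pre suf.
exists (selfsim n ut a x), (profile n ut a x), x; split.
- split.
  + by move=> i t hi t0; rewrite /selfsim mulfK ?gt_eqF ?sqrtr_gt0// profile_xi.
  + move=> i t y iN t0 hy; apply: heat_piece => //.
    exact: (profile_lt_xibar hut ha xi iN hy).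
  + case=> [//|i] t iN t0; apply: stefan_selfsim => //.
    exact: (energy_critical ha xi xmin iN).
  + by move=> y y0; apply: selfsim_cvg_left.
  + by move=> y y0; apply: selfsim_cvg_right.
- by [].
- exact: xi.
- split; first exact: continuous_profile.
  by move=> i hi; apply: profile_xi.
- move=> i z iN /ltW h1 /ltW h2.
  by apply: (profile_piece ut ha xi iN); rewrite h1.
Qed.
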